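(* For $0<k<1$, let $K(k)$ and $E(k)$ be the complete elliptic integrals of the first and second kind, and let $T(k)$, $M(k)$, $H(k)$ be the period, drift and horizontal drift functions defined by integrals in the context. Then $$T(k)=\sqrt{8(1+k^2)}\,K(k),\qquad M(k)=\frac{\sqrt{8(1+k^2)}}{1-k^2}\Bigl(2E(k)-(1-k^2)K(k)\Bigr),$$ and $$H(k)=\frac{4E(k)-2(1-k^2)K(k)}{\sqrt{1-k^2}}.$$
   Context: For $0<k<1$ put $A(k)=\operatorname{arctanh}(k)$ and let $m(k)=\frac{1-k^2}{1+k^2}$ (for a generic unit-speed geodesic of modulus $k$ in $\mathrm{SOL}$ with principal constants of motion $a,b$, one has $2|ab|=m(k)$). Define $$T(k)=4\int_0^{A(k)}\frac{dz}{\sqrt{1-m(k)\cosh(2z)}},\qquad M(k)=4\int_0^{A(k)}\frac{\cosh(2z)\,dz}{\sqrt{1-m(k)\cosh(2z)}},\qquad H(k)=\sqrt{\tfrac{m(k)}{2}}\;M(k).$$ The elliptic integrals use the modulus convention $K(k)=\int_0^{\pi/2}\frac{d\theta}{\sqrt{1-k^2\sin^2\theta}}$, $E(k)=\int_0^{\pi/2}\sqrt{1-k^2\sin^2\theta}\,d\theta$. *)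

(* Defs.v *)
From Stdlib Require Import Reals Lra.
From Coquelicot Require Import Coquelicot.
Open Scope R_scope.

Definition arctanh (x : R) : R := / 2 * ln ((1 + x) / (1 - x)).

Lemma tanh_arctanh (x : R) : -1 < x < 1 -> tanh (arctanh x) = x.
Proof.
intros hx; unfold tanh, sinh, cosh, arctanh.
set (y := / 2 * ln _).
assert (hq : 0 < (1 + x) / (1 - x)) by (apply Rdiv_lt_0_compat; lra).
assert (he := exp_pos y).
assert (h2 : exp y * exp y = (1 + x) / (1 - x)).
{ rewrite <- exp_plus; unfold y.
  replace (/ 2 * _ + _) with (ln ((1 + x) / (1 - x))) by field.
  now apply exp_ln. }
rewrite exp_Ropp.
replace ((exp y - / exp y) / 2 / ((exp y + / exp y) / 2))
  with ((exp y * exp y - 1) / (exp y * exp y + 1)).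
- rewrite h2; field; lra.
- field; repeat split; nra.
Qed.

(* Complete elliptic integrals in the modulus convention (k, not k^2). *)
Definition ellipticK (k : R) : R :=
  RInt (fun theta => / sqrt (1 - k ^ 2 * sin theta ^ 2)) 0 (PI / 2).

Definition ellipticE (k : R) : R :=
  RInt (fun theta => sqrt (1 - k ^ 2 * sin theta ^ 2)) 0 (PI / 2).

Definition A (k : R) : R := arctanh k.

Definition m (k : R) : R := (1 - k ^ 2) / (1 + k ^ 2).

Definition T_integrand (k z : R) : R := / sqrt (1 - m k * cosh (2 * z)).

Definition M_integrand (k z : R) : R :=
  cosh (2 * z) / sqrt (1 - m k * cosh (2 * z)).

(* Since m k * cosh (2 * A k) = 1, both integrands blow up at the upper
   endpoint A k; the integrals from 0 to A k are therefore improper there. *)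
Definition T (k : R) : R :=
  4 * RInt_gen (T_integrand k) (at_point 0) (at_left (A k)).

Definition M (k : R) : R :=
  4 * RInt_gen (M_integrand k) (at_point 0) (at_left (A k)).

Definition H (k : R) : R := sqrt (m k / 2) * M k.

(* Main.v *)
Require Import Defs.
From Stdlib Require Import Reals.
From Coquelicot Require Import Coquelicot.
From Stdlib Require Import Lra.
Open Scope R_scope.

(** Both integrals are brought to Legendre form by one substitution,
    [z = arctanh (k * sin x)] with [0 <= x <= PI / 2]. Write
    [Delta x = sqrt (1 - k^2 * sin x^2)]. Then
    [cosh (2 z) = 2 / Delta^2 - 1], [dz = k * cos x / Delta^2 dx], and
    [1 - m k * cosh (2 z) = 2 / (1 + k^2) * (k * cos x / Delta)^2].
    The factor [cos x], which is responsible for the singularity at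
    [z = A k], therefore cancels, and for every continuous [p]
    the integral of [p (cosh (2 z)) / sqrt (1 - m k * cosh (2 z))] equals
    [sqrt ((1 + k^2) / 2)] times the proper integral of
    [p (2 / Delta^2 - 1) / Delta]. This is [is_RInt_gen_period_integrand], an
    instance of the substitution rule [is_RInt_gen_substitution], whose
    statement includes the convergence of the improper integral.

    Taking [p = 1] gives [ellipticK k], hence [T k]. Taking [p] to be the
    identity gives the integral of [2 / Delta^3 - 1 / Delta], hence [M k], once
    the integral of [1 / Delta^3] is known to be [ellipticE k / (1 - k^2)]
    ([is_RInt_inv_Delta_cube]). The formula for [H k] follows from that for
    [M k], since [sqrt (m k / 2) * sqrt ((1 + k^2) / 2) = sqrt (1 - k^2) / 2]. *)

(** * Substitution that removes an endpoint singularity *)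

(** The proper substitution rule applies on [[a, t]] for each [t < b]. The
    primitive of [g] is continuous up to [b], and the values [phi t] with [t]
    close to [b] fill a left neighbourhood of [phi b], so the truncated integrals
    of [f] converge to the full integral of [g]. *)
Lemma is_RInt_gen_substitution (f phi dphi g : R -> R) (a b : R) :
  a < b ->
  (forall x, a <= x <= b -> is_derive phi x (dphi x)) ->
  (forall x, a <= x <= b -> continuous dphi x) ->
  (forall x y, a <= x < y -> y <= b -> phi x < phi y) ->
  (forall x, a <= x < b -> continuous f (phi x)) ->
  (forall x, continuous g x) ->
  (forall x, a <= x < b -> dphi x * f (phi x) = g x) ->
  is_RInt_gen f (at_point (phi a)) (at_left (phi b)) (RInt g a b).
Proof.
intros hab hphi hdphi hmon hf hg heq.
assert (hex : forall x y, ex_RInt g x y).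
{ intros x y; apply (ex_RInt_continuous (V := R_CompleteNormedModule)).
  intros z _; apply hg. }
assert (hcont : forall x, a <= x <= b -> continuity_pt phi x).
{ intros x hx; apply derivable_continuous_pt, ex_derive_Reals_0.
  eexists; now apply hphi. }
assert (hsurj : forall z, phi a <= z < phi b ->
                  exists x, a <= x < b /\ phi x = z).
{ intros z [[hz | <-] hzb]; [|exists a; split; [lra | reflexivity]].
  destruct (IVT_Rbar_incr phi a b (phi a) (phi b) z) as [x [h1 [h2 h3]]].
  - apply is_lim_continuity, hcont; lra.
  - apply is_lim_continuity, hcont; lra.
  - intros x hx1 hx2; simpl in *; apply hcont; lra.
  - exact hab.
  - now split.
  - simpl in *; exists x; split; [lra | exact h3]. }
assert (hcut : forall t, a <= t < b ->
                 is_RInt f (phi a) (phi t) (RInt g a t)).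
{ intros t ht.
  assert (hle : phi a <= phi t).
  { destruct (proj1 ht) as [h | <-]; [|lra].
    apply Rlt_le, hmon; lra. }
  assert (htb : phi t < phi b) by (apply hmon; lra).
  assert (hval : RInt g a t = RInt f (phi a) (phi t)).
  { apply is_RInt_unique.
    apply is_RInt_ext with (fun y => scal (dphi y) (f (phi y))).
    - rewrite Rmin_left, Rmax_right by lra.
      intros x hx; apply heq; lra.
    - apply (is_RInt_comp (V := R_CompleteNormedModule));
        rewrite Rmin_left, Rmax_right by lra; intros x hx.
      + apply hf; lra.
      + split; [apply hphi | apply hdphi]; lra. }
  rewrite hval.
  apply (RInt_correct (V := R_CompleteNormedModule)), ex_RInt_continuous.
  rewrite Rmin_left, Rmax_right by lra; intros z hz.
  destruct (hsurj z) as [x [hx <-]]; [lra|]; now apply hf. }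
assert (hG : continuous (fun t => RInt g a t) b).
{ apply (continuous_RInt_1 g a).
  apply filter_forall; intros t.
  apply (RInt_correct (V := R_CompleteNormedModule)), hex. }
intros P hP.
destruct (hG P hP) as [d hd].
assert (hd0 := cond_pos d).
(* For t0 < t < b the integral of g up to t satisfies P; halving d makes the inequality b - d < t0 strict. *)
set (t0 := Rmax a (b - d / 2)).
assert (ht0 : a <= t0 < b /\ b - d < t0).
{ unfold t0, Rmax; destruct Rle_dec; lra. }
assert (h0 : phi t0 < phi b) by (apply hmon; lra).
assert (ha0 : phi a <= phi t0).
{ destruct (proj1 (proj1 ht0)) as [h | <-]; [|lra].
  apply Rlt_le, hmon; lra. }
apply Filter_prod with (fun u => u = phi a) (fun v => phi t0 < v < phi b).
- reflexivity.
- exists (mkposreal _ (proj2 (Rlt_0_minus _ _) h0)); intros v hv hvb.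
  change (Rabs (v - phi b) < phi b - phi t0) in hv.
  apply Rabs_def2 in hv; lra.
- intros u v -> hv; simpl.
  destruct (hsurj v) as [t [ht <-]]; [lra|].
  assert (htt : t0 < t).
  { apply Rnot_le_lt; intros [h | ->]; [|lra].
    assert (phi t < phi t0) by (apply hmon; lra); lra. }
  exists (RInt g a t); split; [now apply hcut|].
  apply hd; change (Rabs (t - b) < d); apply Rabs_def1; lra.
Qed.

(** * The inverse hyperbolic tangent *)

Lemma cosh_double_arctanh (u : R) :
  -1 < u < 1 -> cosh (2 * arctanh u) = (1 + u ^ 2) / (1 - u ^ 2).
Proof.
intros hu; unfold cosh, arctanh.
assert (hq : 0 < (1 + u) / (1 - u)) by (apply Rdiv_lt_0_compat; lra).
replace (2 * (/ 2 * ln ((1 + u) / (1 - u))))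
  with (ln ((1 + u) / (1 - u))) by field.
rewrite exp_Ropp, exp_ln by exact hq.
assert (hu2 : 0 < 1 - u ^ 2) by nra.
field; lra.
Qed.

Lemma is_derive_arctanh (u : R) :
  -1 < u < 1 -> is_derive arctanh u (/ (1 - u ^ 2)).
Proof.
intros hu; assert (hu2 : 0 < 1 - u ^ 2) by nra.
unfold arctanh; auto_derive.
- repeat split; try lra; apply Rdiv_lt_0_compat; lra.
- field; lra.
Qed.

Lemma arctanh_lt (u v : R) : -1 < u -> u < v -> v < 1 -> arctanh u < arctanh v.
Proof.
intros hu huv hv; unfold arctanh.
apply Rmult_lt_compat_l; [lra|].
apply ln_increasing; [apply Rdiv_lt_0_compat; lra|].
apply Rlt_0_minus.
replace ((1 + v) / (1 - v) - (1 + u) / (1 - u))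
  with (2 * (v - u) / ((1 - v) * (1 - u))) by (field; lra).
apply Rdiv_lt_0_compat; nra.
Qed.

(** * The Legendre radical and the integral of its inverse cube *)

Definition Delta (k x : R) : R := sqrt (1 - k ^ 2 * sin x ^ 2).

Lemma ksin_bounds (k x : R) : 0 < k < 1 -> -1 < k * sin x < 1.
Proof. intros hk; assert (h := SIN_bound x); nra. Qed.

Lemma Delta_radicand_pos (k x : R) : 0 < k < 1 -> 0 < 1 - k ^ 2 * sin x ^ 2.
Proof. intros hk; assert (h := ksin_bounds k x hk); nra. Qed.

Lemma Delta_pos (k x : R) : 0 < k < 1 -> 0 < Delta k x.
Proof. intros hk; now apply sqrt_lt_R0, Delta_radicand_pos. Qed.

Lemma Delta_sq (k x : R) : 0 < k < 1 -> Delta k x ^ 2 = 1 - k ^ 2 * sin x ^ 2.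
Proof. intros hk; now apply pow2_sqrt, Rlt_le, Delta_radicand_pos. Qed.

Lemma is_derive_Delta (k x : R) : 0 < k < 1 ->
  is_derive (Delta k) x (- (k ^ 2 * sin x * cos x) / Delta k x).
Proof.
intros hk.
assert (h := Delta_radicand_pos k x hk); assert (hp := Delta_pos k x hk).
unfold Delta in *; auto_derive; [exact h|].
replace (1 + - _) with (1 - k ^ 2 * sin x ^ 2) by ring.
field; lra.
Qed.

Lemma continuous_Delta (k x : R) : 0 < k < 1 -> continuous (Delta k) x.
Proof.
intros hk; apply (ex_derive_continuous (V := R_NormedModule)).
eexists; now apply is_derive_Delta.
Qed.

Lemma continuous_inv_Delta_pow (k : R) (n : nat) (x : R) : 0 < k < 1 ->
  continuous (fun t => / Delta k t ^ n) x.
Proof.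
intros hk; apply (ex_derive_continuous (V := R_NormedModule)).
assert (hp := Delta_pos k x hk).
auto_derive; split; [|split; [|easy]].
- eexists; now apply is_derive_Delta.
- apply Rgt_not_eq, pow_lt, hp.
Qed.

(** The function [sin x * cos x / Delta x] vanishes at both [0] and [PI / 2],
    and [k^2] times its derivative is [Delta - (1 - k^2) / Delta^3]; so the
    integrals of [Delta] and of [(1 - k^2) / Delta^3] agree. *)
Lemma is_RInt_inv_Delta_cube (k : R) : 0 < k < 1 ->
  is_RInt (fun x => / Delta k x ^ 3) 0 (PI / 2) (ellipticE k / (1 - k ^ 2)).
Proof.
intros hk; assert (hk2 : 0 < 1 - k ^ 2) by nra.
set (F := fun x => sin x * cos x / Delta k x).
set (dF := fun x => (Delta k x - (1 - k ^ 2) * / Delta k x ^ 3) / k ^ 2).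
assert (hF : is_RInt dF 0 (PI / 2) 0).
{ replace 0 with (minus (F (PI / 2)) (F 0)) at 2.
  - apply (is_RInt_derive (V := R_CompleteNormedModule) F dF); intros x _.
    + assert (hp := Delta_pos k x hk); assert (hs := Delta_sq k x hk).
      assert (hd := is_derive_Delta k x hk).
      unfold F; auto_derive.
      * repeat split; [eexists; exact hd | lra].
      * rewrite (is_derive_unique (fun t : R => Delta k t) _ _ hd).
        assert (hc := sin2_cos2 x); unfold Rsqr in hc.
        set (D := Delta k x) in *; set (sx := sin x) in *; set (cx := cos x) in *.
        unfold dF; fold D.
        (* Clearing denominators leaves a polynomial identity in sx once
           D^2 = 1 - k^2 sx^2 and cx^2 = 1 - sx^2 are substituted. *)
        assert (hc' : cx ^ 2 = 1 - sx ^ 2) by lra.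
        apply Rmult_eq_reg_r with (k ^ 2 * D ^ 3);
          [|apply Rgt_not_eq, Rmult_lt_0_compat; apply pow_lt; lra].
        transitivity (k ^ 2 * ((cx ^ 2 - sx ^ 2) * D ^ 2
                      + k ^ 2 * (sx ^ 2 * cx ^ 2))).
        { field; lra. }
        transitivity ((D ^ 2) ^ 2 - (1 - k ^ 2)); [|field; lra].
        rewrite hs, hc'; ring.
    + apply (continuous_mult (K := R_AbsRing)
               (fun x => Delta k x - (1 - k ^ 2) * / Delta k x ^ 3)
               (fun _ => / k ^ 2)); [|apply continuous_const].
      apply (continuous_minus (V := R_NormedModule));
        [now apply continuous_Delta|].
      apply (continuous_scal_r (K := R_AbsRing) (V := R_NormedModule)).
      now apply continuous_inv_Delta_pow.
  - unfold F; rewrite sin_0, cos_PI2; unfold minus, plus, opp; simpl; field.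
    split; apply Rgt_not_eq, Delta_pos, hk. }
assert (hE : is_RInt (Delta k) 0 (PI / 2) (ellipticE k)).
{ apply (RInt_correct (V := R_CompleteNormedModule)).
  apply (ex_RInt_continuous (V := R_CompleteNormedModule)); intros x _.
  now apply continuous_Delta. }
replace (ellipticE k / (1 - k ^ 2))
  with (/ (1 - k ^ 2) * (ellipticE k - k ^ 2 * 0)) by (field; lra).
apply is_RInt_ext with
  (fun x => / (1 - k ^ 2) * (Delta k x - k ^ 2 * dF x)).
- intros x _; assert (hp := Delta_pos k x hk); unfold dF.
  change (/ (1 - k ^ 2)
          * (Delta k x - k ^ 2 * ((Delta k x - (1 - k ^ 2) * / Delta k x ^ 3)
                                  / k ^ 2)) = / Delta k x ^ 3).
  field; repeat split; lra.
- apply (is_RInt_scal (V := R_NormedModule)).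
  apply (is_RInt_minus (V := R_NormedModule)); [exact hE|].
  apply (is_RInt_scal (V := R_NormedModule)); exact hF.
Qed.

(** * Reduction of the period integrals to Legendre form *)

(** The numerator is left general so that the period ([p] constant) and the
    drift ([p] the identity) share one change of variables. *)
Lemma is_RInt_gen_period_integrand (k : R) (p : R -> R) :
  0 < k < 1 ->
  (forall c, continuous p c) ->
  is_RInt_gen (fun z => p (cosh (2 * z)) / sqrt (1 - m k * cosh (2 * z)))
    (at_point 0) (at_left (A k))
    (sqrt ((1 + k ^ 2) / 2)
     * RInt (fun x => p (2 / Delta k x ^ 2 - 1) / Delta k x) 0 (PI / 2)).
Proof.
intros hk hp.
set (phi := fun x => arctanh (k * sin x)).
set (c := sqrt ((1 + k ^ 2) / 2)).
assert (hc : 0 < c) by (apply sqrt_lt_R0; nra).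
assert (hphi0 : phi 0 = 0).
{ unfold phi, arctanh; rewrite sin_0.
  replace ((1 + k * 0) / (1 - k * 0)) with 1 by field; rewrite ln_1; ring. }
assert (hphiA : phi (PI / 2) = A k).
{ unfold phi, A; rewrite sin_PI2; f_equal; ring. }
assert (hpi := PI_RGT_0).
assert (hcosh : forall x, cosh (2 * phi x) = 2 / Delta k x ^ 2 - 1).
{ intros x; unfold phi; rewrite cosh_double_arctanh by now apply ksin_bounds.
  assert (hr := Delta_radicand_pos k x hk).
  rewrite Delta_sq by exact hk; field; lra. }
assert (hcos : forall x, 0 <= x < PI / 2 -> 0 < cos x).
{ intros x hx; apply cos_gt_0; lra. }
assert (hrad : forall x, 1 - m k * cosh (2 * phi x)
                 = (k * cos x / (c * Delta k x)) ^ 2).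
{ intros x; rewrite hcosh; unfold m.
  assert (hr := Delta_radicand_pos k x hk).
  assert (hc2 : c ^ 2 = (1 + k ^ 2) / 2) by (apply pow2_sqrt; nra).
  replace ((k * cos x / (c * Delta k x)) ^ 2)
    with (k ^ 2 * cos x ^ 2 / (c ^ 2 * Delta k x ^ 2)).
  - rewrite hc2, Delta_sq by exact hk.
    assert (h := sin2_cos2 x); unfold Rsqr in h.
    replace (cos x ^ 2) with (1 - sin x ^ 2) by lra.
    field; nra.
  - field; split; apply Rgt_not_eq; [now apply Delta_pos | exact hc]. }
assert (hcontg : forall x,
          continuous (fun x => p (2 / Delta k x ^ 2 - 1) / Delta k x) x).
{ intros x.
  apply (continuous_mult (K := R_AbsRing)
           (fun x => p (2 / Delta k x ^ 2 - 1)) (fun x => / Delta k x)).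
  - apply (continuous_comp (fun x => 2 / Delta k x ^ 2 - 1) p); [|apply hp].
    assert (h2 := Delta_pos k x hk).
    apply (ex_derive_continuous (V := R_NormedModule)).
    auto_derive; split; [eexists; now apply is_derive_Delta|].
    split; [apply Rgt_not_eq; nra | easy].
  - apply continuous_ext with (fun x => / Delta k x ^ 1);
      [intros t; now rewrite pow_1 | now apply continuous_inv_Delta_pow]. }
replace (at_point 0) with (at_point (phi 0)) by (now rewrite hphi0).
rewrite <- hphiA.
rewrite <- (RInt_scal (V := R_CompleteNormedModule)).
- apply is_RInt_gen_substitution with (dphi := fun x => k * cos x / Delta k x ^ 2).
  + lra.
  + intros x _; unfold phi.
    assert (hr := Delta_radicand_pos k x hk).
    assert (hd := is_derive_arctanh _ (ksin_bounds k x hk)).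
    rewrite Delta_sq by exact hk.
    auto_derive; [eexists; exact hd|].
    rewrite (is_derive_unique (fun t : R => arctanh t) _ _ hd); field; lra.
  + intros x _.
    apply (continuous_mult (K := R_AbsRing) (fun x => k * cos x)
             (fun x => / Delta k x ^ 2));
      [|now apply continuous_inv_Delta_pow].
    apply (ex_derive_continuous (V := R_NormedModule)); auto_derive; easy.
  + intros x y hx hy; apply arctanh_lt; try apply ksin_bounds; try lra.
    apply Rmult_lt_compat_l; [lra|]; apply sin_increasing_1; lra.
  + intros x hx.
    assert (hpos : 0 < 1 - m k * cosh (2 * phi x)).
    { rewrite hrad; apply pow_lt, Rdiv_lt_0_compat; apply Rmult_lt_0_compat;
        try lra; [now apply hcos | now apply Delta_pos]. }
    assert (hco : forall z, continuous (fun z => cosh (2 * z)) z).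
    { intros z; apply (ex_derive_continuous (V := R_NormedModule)).
      unfold cosh; auto_derive; easy. }
    apply (continuous_mult (K := R_AbsRing) (fun z => p (cosh (2 * z)))
             (fun z => / sqrt (1 - m k * cosh (2 * z)))).
    * apply (continuous_comp (fun z => cosh (2 * z)) p); [apply hco | apply hp].
    * apply (ex_derive_continuous (V := R_NormedModule)).
      unfold cosh in *; auto_derive; repeat split; try exact hpos.
      now apply Rgt_not_eq, sqrt_lt_R0.
  + intros x; apply (continuous_scal_r (K := R_AbsRing) (V := R_NormedModule) c).
    now apply hcontg.
  + intros x hx; rewrite hrad, hcosh.
    assert (h1 := hcos x hx); assert (h2 := Delta_pos k x hk).
    rewrite sqrt_pow2.
    * unfold scal; simpl; unfold mult; simpl; field; repeat split; lra.
    * apply Rlt_le, Rdiv_lt_0_compat; apply Rmult_lt_0_compat; lra.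
- apply (ex_RInt_continuous (V := R_CompleteNormedModule)); intros x _.
  now apply hcontg.
Qed.

Theorem propositionA3 (k : R) (hk : 0 < k < 1) :
  ex_RInt_gen (T_integrand k) (at_point 0) (at_left (A k)) /\
  ex_RInt_gen (M_integrand k) (at_point 0) (at_left (A k)) /\
  T k = sqrt (8 * (1 + k ^ 2)) * ellipticK k /\
  M k = sqrt (8 * (1 + k ^ 2)) / (1 - k ^ 2)
        * (2 * ellipticE k - (1 - k ^ 2) * ellipticK k) /\
  H k = (4 * ellipticE k - 2 * (1 - k ^ 2) * ellipticK k) / sqrt (1 - k ^ 2).
Proof.
assert (hk2 : 0 < 1 - k ^ 2) by nra.
set (c := sqrt ((1 + k ^ 2) / 2)).
assert (hc : sqrt (8 * (1 + k ^ 2)) = 4 * c).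
{ replace (8 * (1 + k ^ 2)) with (4 ^ 2 * ((1 + k ^ 2) / 2)) by field.
  rewrite sqrt_mult by nra; rewrite sqrt_pow2 by lra; reflexivity. }
assert (hT : is_RInt_gen (T_integrand k) (at_point 0) (at_left (A k))
               (c * ellipticK k)).
{ replace (ellipticK k)
    with (RInt (fun x => (fun _ => 1) (2 / Delta k x ^ 2 - 1) / Delta k x)
            0 (PI / 2)).
  - apply is_RInt_gen_ext with
      (fun z => (fun _ => 1) (cosh (2 * z)) / sqrt (1 - m k * cosh (2 * z))).
    + apply filter_forall; intros ab z _; exact (Rmult_1_l _).
    + apply (is_RInt_gen_period_integrand k (fun _ => 1)); [exact hk|].
      intros x; apply continuous_const.
  - apply RInt_ext; intros x _; unfold Rdiv; rewrite Rmult_1_l; reflexivity. }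
assert (hM : is_RInt_gen (M_integrand k) (at_point 0) (at_left (A k))
               (c * (2 * (ellipticE k / (1 - k ^ 2)) - ellipticK k))).
{ replace (2 * (ellipticE k / (1 - k ^ 2)) - ellipticK k)
    with (RInt (fun x => (fun y => y) (2 / Delta k x ^ 2 - 1) / Delta k x)
            0 (PI / 2)).
  - apply (is_RInt_gen_period_integrand k (fun y => y)); [exact hk|].
    intros x; apply continuous_id.
  - apply is_RInt_unique.
    apply is_RInt_ext with (fun x => 2 * / Delta k x ^ 3 - / Delta k x ^ 1).
    + intros x _; assert (h := Delta_pos k x hk).
      change (2 * / Delta k x ^ 3 - / Delta k x ^ 1
              = (2 / Delta k x ^ 2 - 1) / Delta k x).
      field; lra.
    + apply (is_RInt_minus (V := R_NormedModule)).
      * apply (is_RInt_scal (V := R_NormedModule)).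
        now apply is_RInt_inv_Delta_cube.
      * apply is_RInt_ext with (fun x => / Delta k x);
          [intros x _; now rewrite pow_1|].
        apply (RInt_correct (V := R_CompleteNormedModule)).
        apply (ex_RInt_continuous (V := R_CompleteNormedModule)); intros x _.
        apply continuous_ext with (fun x => / Delta k x ^ 1);
          [intros t; now rewrite pow_1 | now apply continuous_inv_Delta_pow]. }
assert (hTk : T k = 4 * (c * ellipticK k)).
{ unfold T; f_equal; now apply is_RInt_gen_unique. }
assert (hMk : M k = 4 * (c * (2 * (ellipticE k / (1 - k ^ 2)) - ellipticK k))).
{ unfold M; f_equal; now apply is_RInt_gen_unique. }
split; [now eexists; exact hT|].
split; [now eexists; exact hM|].
split; [rewrite hTk, hc; ring|].
split; [rewrite hMk, hc; field; lra|].
unfold H; rewrite hMk.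
assert (hsc : sqrt (m k / 2) * c = sqrt (1 - k ^ 2) / 2).
{ unfold c; rewrite <- sqrt_mult.
  - replace (m k / 2 * ((1 + k ^ 2) / 2)) with ((1 - k ^ 2) / 2 ^ 2)
      by (unfold m; field; nra).
    rewrite sqrt_div by nra; now rewrite sqrt_pow2 by lra.
  - unfold m; apply Rlt_le; repeat apply Rdiv_lt_0_compat; nra.
  - nra. }
assert (hs := sqrt_lt_R0 _ hk2).
assert (hs2 : sqrt (1 - k ^ 2) ^ 2 = 1 - k ^ 2) by (apply pow2_sqrt; lra).
transitivity (4 * (sqrt (m k / 2) * c)
              * (2 * (ellipticE k / (1 - k ^ 2)) - ellipticK k)); [ring|].
rewrite hsc; set (s := sqrt (1 - k ^ 2)) in *.
rewrite <- hs2; field; lra.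
Qed.
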